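(* Let $\omega=(T,c,T_1,\dots,T_m,c_1,\dots,c_m,\alpha_1,\dots,\alpha_m)\in\Omega$ be such that $\langle x,Tx\rangle$ is a Legendre form on $\mathcal H$. Then the set-valued map $\mathrm{Sol}(\cdot):\Omega\rightrightarrows\mathcal H$ is upper semicontinuous at $\omega$ if the following two conditions are satisfied: (i) $\mathrm{Sol}(QPR_\omega)=\{0\}$; (ii) the system $g_i(x,\omega)\leqslant 0$, $i=1,\dots,m$, is regular.
   Context: $\mathcal H$ is a real Hilbert space with inner product $\langle\cdot,\cdot\rangle$ and norm $\|\cdot\|$; $\mathcal L(\mathcal H)$ is the space of continuous linear operators on $\mathcal H$ with the operator norm; $m\geqslant 1$ is a fixed integer. $\Omega$ is the set of all $\omega=(T,c,T_1,\dots,T_m,c_1,\dots,c_m,\alpha_1,\dots,\alpha_m)\in \mathcal L(\mathcal H)\times\mathcal H\times\mathcal L(\mathcal H)^m\times\mathcal H^m\times\mathbb R^m$ such that $T$ is self-adjoint and each $T_i$ is self-adjoint and positive semidefinite. Product spaces carry the max norm, so $\|\omega-\omega'\|$ is the maximum of the norms of the componentwise differences. For $\omega\in\Omega$ and $x\in\mathcal H$: $f(x,\omega)=\frac12\langle x,Tx\rangle+\langle c,x\rangle$; $g_i(x,\omega)=\frac12\langle x,T_ix\rangle+\langle c_i,x\rangle+\alpha_i$ for $i=1,\dots,m$; $F(\omega)=\{x\in\mathcal H: g_i(x,\omega)\leqslant 0,\ i=1,\dots,m\}$. The optimal value function is $\varphi(\omega)=\inf\{f(x,\omega):x\in F(\omega)\}$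 (possibly $-\infty$) if $F(\omega)\ne\emptyset$, and $\varphi(\omega)=+\infty$ if $F(\omega)=\emptyset$. The solution set is $\mathrm{Sol}(\omega)=\{x\in F(\omega): f(x,\omega)=\varphi(\omega)\}$. The recession cone of the constraint set is $0^+F(\omega)=\{v\in\mathcal H: T_iv=0,\ \langle c_i,v\rangle\leqslant 0,\ i=1,\dots,m\}$. $(QPR_\omega)$ is the problem of minimizing $\frac12\langle v,Tv\rangle$ over $v\in 0^+F(\omega)$, and $\mathrm{Sol}(QPR_\omega)$ is its set of (global) minimizers. The system $g_i(x,\omega)\leqslant0$, $i=1,\dots,m$, is regular if there is $x^0\in\mathcal H$ with $g_i(x^0,\omega)<0$ for all $i=1,\dots,m$. A quadratic form $Q:\mathcal H\to\mathbb R$ is a Legendre form if it is weakly (sequentially) lower semicontinuous and $x_k\to x_0$ in norm whenever $x_k$ converges weakly to $x_0$ and $Q(x_k)\to Q(x_0)$. A set-valued map $S$ into $\mathcal H$ is upper semicontinuous at $\omega\in\Omega$ if for each (norm-)open $V\subset\mathcal H$ with $S(\omega)\subset V$ there is $\varepsilon>0$ such that $S(\omega')\subset V$ for all $\omega'\in\Omega$ with $\|\omega'-\omega\|<\varepsilon$. *)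

(* Defs.v *)
From HB Require Import structures.
From mathcomp Require Import all_boot all_order all_algebra.
From mathcomp Require Import all_classical all_reals all_analysis.

Set Implicit Arguments.
Unset Strict Implicit.
Unset Printing Implicit Defensive.

Import Order.TTheory GRing.Theory Num.Theory.
Import numFieldNormedType.Exports.

Local Open Scope classical_set_scope.
Local Open Scope ring_scope.

HB.mixin Record isHilbert (R : realType) H of CompleteNormedModule R H := {
  inner : {dot H for (idfun : R -> R)} ;
  sqr_norm_inner : forall x : H, `|x| ^+ 2 = inner x x
}.

#[short(type="hilbertType")]
HB.structure Definition Hilbert (R : realType) :=
  {H of isHilbert R H & CompleteNormedModule R H}.

Section HilbertNotions.
Context {R : realType} {H : hilbertType R}.
Implicit Types (A : H -> H) (Q : H -> R).

Record operator := Operator {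
  operator_linear :> {linear H -> H} ;
  operator_continuous : continuous operator_linear
}.

(* Only meaningful when A is linear and continuous: [sup] is 0 on a set that
   is not bounded above. *)
Definition opnorm A : R := sup [set `|A x| | x in [set x : H | `|x| <= 1]].

Definition self_adjoint A : Prop := forall x y, inner (A x) y = inner x (A y).

Definition positive_semidefinite A : Prop := forall x, 0 <= inner x (A x).

Definition weak_cvg (x : nat -> H) (x0 : H) : Prop :=
  forall y, (fun k => inner (x k) y) @ \oo --> inner x0 y.

Definition weakly_lsc Q : Prop := forall (x : nat -> H) (x0 : H),
  weak_cvg x x0 -> ((Q x0)%:E <= limn_einf (fun k => (Q (x k))%:E))%E.

Definition quadratic_form Q : Prop :=
  exists B : {symmetric H}, forall x, Q x = B x x.

Definition Legendre_form Q : Prop :=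
  [/\ quadratic_form Q,
      weakly_lsc Q
    & forall (x : nat -> H) (x0 : H),
        weak_cvg x x0 -> (fun k => Q (x k)) @ \oo --> Q x0 ->
        x @ \oo --> x0].

End HilbertNotions.

Arguments operator {R} H.

Record qp_data (R : realType) (H : hilbertType R) (m : nat) := QPData {
  obj_op : operator H ;
  obj_vec : H ;
  cons_op : 'I_m -> operator H ;
  cons_vec : 'I_m -> H ;
  cons_cst : 'I_m -> R
}.

Section QuadraticPrograms.
Context {R : realType} {H : hilbertType R} {m : nat}.
Implicit Types (w : qp_data H m) (x v : H).

Definition Omega : set (qp_data H m) := [set w |
  self_adjoint (obj_op w) /\
  forall i, self_adjoint (cons_op w i) /\ positive_semidefinite (cons_op w i)].

Definition qp_dist w w' : R :=
  Num.max (opnorm (obj_op w \- obj_op w'))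
  (Num.max `|obj_vec w - obj_vec w'|
  (Num.max (\big[Num.max/0]_(i < m) opnorm (cons_op w i \- cons_op w' i))
  (Num.max (\big[Num.max/0]_(i < m) `|cons_vec w i - cons_vec w' i|)
           (\big[Num.max/0]_(i < m) `|cons_cst w i - cons_cst w' i|)))).

Definition objective x w : R :=
  2^-1 * inner x (obj_op w x) + inner (obj_vec w) x.

Definition constraint (i : 'I_m) x w : R :=
  2^-1 * inner x (cons_op w i x) + inner (cons_vec w i) x + cons_cst w i.

Definition feasible w : set H := [set x | forall i, constraint i x w <= 0].

(* [ereal_inf set0 = +oo], as wanted for an infeasible problem. *)
Definition optimal_value w : \bar R :=
  ereal_inf [set (objective x w)%:E | x in feasible w].

Definition Sol w : set H :=
  [set x | feasible w x /\ (objective x w)%:E = optimal_value w].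

Definition recession_cone w : set H :=
  [set v | forall i, cons_op w i v = 0 /\ inner (cons_vec w i) v <= 0].

Definition SolQPR w : set H :=
  [set v | recession_cone w v /\
    forall u, recession_cone w u ->
      2^-1 * inner v (obj_op w v) <= 2^-1 * inner u (obj_op w u)].

Definition regular_system w : Prop := exists x0, forall i, constraint i x0 w < 0.

Definition usc_at (S : qp_data H m -> set H) w : Prop :=
  forall V : set H, open V -> S w `<=` V ->
    exists2 e : R, 0 < e &
      forall w', Omega w' -> qp_dist w' w < e -> S w' `<=` V.

End QuadraticPrograms.

(* Main.v *)
Require Import Defs.
From mathcomp Require Import all_boot all_order all_algebra.
From mathcomp Require Import all_classical all_reals all_analysis.
From mathcomp Require Import ring lra.

Set Implicit Arguments.
Unset Strict Implicit.
Unset Printing Implicit Defensive.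

Import Order.TTheory GRing.Theory Num.Theory.
Import numFieldNormedType.Exports.

Local Open Scope classical_set_scope.
Local Open Scope ring_scope.

(** The proof is by contradiction. If upper semicontinuity fails, there are an
    open [V] containing [Sol w], data [W k] tending to [w] and solutions
    [x k] of [W k] outside [V]. Two cases cover everything.

    Bounded case. A bounded sequence of a Hilbert space has a weakly convergent
    subsequence ([bounded_weak_subseq]); let [x0] be its weak limit. Convex
    continuous constraints are weakly lower semicontinuous, so [x0] is feasible.
    A strictly feasible point of [w] stays feasible for [W k] once [k] is large,
    hence competes with [x k]; since regularity makes strictly feasible points
    dense in the feasible set, passing to the limit gives both that [x0] is a
    solution and that the upper limit of [<x k, T (x k)>] is at most
    [<x0, T x0>]. The Legendre property upgrades weak to strong convergence, so
    [x k] enters [V] ([Sol_weak_limit]).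

    Unbounded case. The norms tend to infinity, and the unit vectors
    [x k / |x k|] have a weak limit [v] along a subsequence. Dividing the
    constraints and the comparison with a fixed strictly feasible point by
    [|x k|^2], and the constraints without their quadratic term by [|x k|],
    shows that [v] is a recession direction and that the upper limit of the
    quadratic objective along these unit vectors is at most 0
    ([normalized_Sol_weak_limit]). As 0 is the only minimiser over the recession
    cone, [v = 0]; then the Legendre property makes unit vectors converge
    strongly to 0, which is absurd.

    Weak compactness is obtained without separability or nested subsequences:
    limits along an ultrafilter on [nat] define a bounded functional, which is
    represented by a vector ([Riesz_closed_subspace]). *)

(** * Inner products, Riesz representation and projection *)

Section InnerProduct.
Context {R : realType} {H : hilbertType R}.
Implicit Types (x y z : H) (a : R).

Lemma innerC x y : inner x y = inner y x.
Proof. by rewrite (hermC inner) expr0 mul1r. Qed.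

Lemma innerDl x y z : inner (x + y) z = inner x z + inner y z.
Proof. exact: linearDl. Qed.

Lemma innerDr x y z : inner z (x + y) = inner z x + inner z y.
Proof. exact: linearDr. Qed.

Lemma innerZl a x y : inner (a *: x) y = a * inner x y.
Proof. exact: linearZl_LR. Qed.

Lemma innerZr a x y : inner x (a *: y) = a * inner x y.
Proof. by rewrite innerC innerZl innerC. Qed.

Lemma innerNl x y : inner (- x) y = - inner x y.
Proof. by rewrite -scaleN1r innerZl mulN1r. Qed.

Lemma innerNr x y : inner x (- y) = - inner x y.
Proof. by rewrite innerC innerNl innerC. Qed.

Lemma inner0l x : inner 0 x = 0.
Proof. by rewrite -(scale0r 0) innerZl mul0r. Qed.

Lemma inner0r x : inner x 0 = 0.
Proof. by rewrite innerC inner0l. Qed.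

Lemma inner_ge0 x : 0 <= inner x x.
Proof. by rewrite -sqr_norm_inner sqr_ge0. Qed.

Definition innerE := (innerDl, innerDr, innerNl, innerNr, innerZl, innerZr).

Lemma inner_CauchySchwarz x y : `|inner x y| <= `|x| * `|y|.
Proof.
have [->|y0] := eqVneq y 0; first by rewrite inner0r !normr0 mulr0.
rewrite -(@ler_pXn2r _ 2) ?nnegrE ?mulr_ge0 // exprMn !sqr_norm_inner.
rewrite real_normK ?num_real //.
have yy0 : 0 < inner y y by rewrite -sqr_norm_inner exprn_gt0 ?normr_gt0.
have := inner_ge0 (inner y y *: x - inner x y *: y).
rewrite !innerE (innerC y x) => h.
rewrite -(ler_pM2l yy0); nra.
Qed.

Lemma cvg_innerl {T} (F : set_system T) {FF : Filter F} (f : T -> H) l y :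
  f @ F --> l -> inner (f t) y @[t --> F] --> inner l y.
Proof.
move=> /cvgrPdist_le fl; apply/cvgrPdist_le => e e0.
have y1 : 0 < `|y| + 1 by rewrite ltr_wpDl.
near=> t.
rewrite -innerNl -innerDl (le_trans (inner_CauchySchwarz _ _)) //.
have: `|l - f t| <= e / (`|y| + 1).
  by near: t; apply: fl; rewrite divr_gt0.
rewrite ler_pdivlMr //; apply: le_trans.
by rewrite ler_wpM2l // lerDl.
Unshelve. all: by end_near. Qed.

(** Quadratic growth makes the functional [`|x|^2 - 2 phi x] bounded below on
    [M], and the parallelogram law makes every minimising sequence Cauchy; its
    limit represents [phi]. Taking [phi := inner y] yields the orthogonal
    projection of [y] onto [M], taking [M := setT] the usual Riesz theorem. *)
Lemma Riesz_closed_subspace (M : set H) (phi : H -> R) (C : R) :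
  M 0 -> (forall a x y, M x -> M y -> M (a *: x + y)) -> closed M ->
  (forall a x y, phi (a *: x + y) = a * phi x + phi y) ->
  (forall x, `|phi x| <= C * `|x|) ->
  exists2 z, M z & forall y, M y -> phi y = inner z y.
Proof.
move=> M0 Mlin Mcl philin phibd.
pose J x := inner x x - 2 * phi x.
have Jlb x : - C ^+ 2 <= J x.
  have := phibd x; rewrite /J -sqr_norm_inner ler_norml => /andP[_ h].
  have := sqr_ge0 (`|x| - C); nra.
pose E := [set J x | x in M].
have Einf : has_inf E.
  by split; [exists (J 0), 0|exists (- C ^+ 2) => _ [x _ <-]].
have Ige x : M x -> inf E <= J x.
  by move=> Mx; apply: ge_inf; [case: Einf|exists x].
have /choice[z zP] (n : nat) : exists z, M z /\ J z < inf E + n.+1%:R^-1.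
  have [|_ [x Mx <-] h] := @inf_adherent _ E n.+1%:R^-1 _ Einf.
    by rewrite invr_gt0.
  by exists x.
have MZ a x : M x -> M (a *: x).
  by move=> Mx; rewrite -[_ *: _]addr0; apply: Mlin.
have phi0 : phi 0 = 0.
  have := philin 1 0 0; rewrite scale1r addr0; lra.
have phiZ a x : phi (a *: x) = a * phi x.
  by rewrite -[_ *: _]addr0 philin phi0 addr0.
have zz n p : `|z n - z p| ^+ 2 <= 2 * (n.+1%:R^-1 + p.+1%:R^-1).
  have [[Mn Jn] [Mp Jp]] := (zP n, zP p).
  have Mm : M (2^-1 *: (1 *: z n + z p)) by apply: MZ; apply: Mlin.
  have := Ige _ Mm; move: Jn Jp.
  rewrite /J sqr_norm_inner !innerE phiZ philin !(innerC (z p) (z n)).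
  move: n.+1%:R^-1 p.+1%:R^-1 => en ep; lra.
have zc : cvgn z.
  apply/cauchy_cvgP/cauchy_exP => e e0.
  have e4 : 0 < e ^+ 2 / 4 by rewrite divr_gt0 // exprn_gt0.
  have /cvgrPdist_lt/(_ _ e4) := @cvg_harmonic R.
  move=> [N _ hN]; exists (z N); exists N => // n /= Nn.
  rewrite -ball_normE /= -(@ltr_pXn2r _ 2) ?nnegrE ?normr_ge0 ?(ltW e0) //.
  apply: le_lt_trans (zz _ _) _.
  have := hN _ Nn; have := hN _ (leqnn N).
  rewrite /= !sub0r !normrN !ger0_norm ?invr_ge0 //.
  move: n.+1%:R^-1 N.+1%:R^-1 => en eN; lra.
exists (limn z).
  by apply: (closed_cvg _ Mcl _ _ zc); near=> n; have [] := zP n.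
move=> y My.
have hz : inner (z n) y @[n --> \oo] --> inner (limn z) y.
  exact: cvg_innerl.
pose u n : R := inner (z n) y - phi y.
have ul : u @ \oo --> (inner (limn z) y - phi y : R).
  by apply: cvgB; [exact: hz|exact: cvg_cst].
(* Optimality of [z n] up to [n.+1^-1] along the line [z n + R y]. *)
have dev n : u n * u n <= n.+1%:R^-1 * inner y y.
  have [y0|y0] := eqVneq y 0; first by rewrite /u y0 !inner0r phi0 subrr mul0r mulr0.
  have yy0 : 0 < inner y y by rewrite -sqr_norm_inner exprn_gt0 ?normr_gt0.
  have [Mn Jn] := zP n.
  rewrite -ler_pdivrMr // ltW //.
  pose t := - u n / inner y y.
  have -> : u n * u n / inner y y = - (2 * t * u n + t ^+ 2 * inner y y).
    by rewrite /t; field; rewrite gt_eqF.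
  have := Ige _ (Mlin t _ _ My Mn); move: Jn.
  rewrite /J philin !innerE (innerC y (z n)) /u.
  move: n.+1%:R^-1 => en; nra.
have dev0 : (u \* u) @ \oo --> (0 : R).
  apply: (@squeeze_cvgr _ _ _ _ (fun=> 0) (fun n => n.+1%:R^-1 * inner y y)).
  - by near=> n; rewrite /= dev -expr2 sqr_ge0.
  - exact: cvg_cst.
  - rewrite -[X in _ --> X](mul0r (inner y y)).
    by apply: cvgM; [exact: cvg_harmonic|exact: cvg_cst].
have uul : (u \* u) @ \oo --> (inner (limn z) y - phi y) ^+ 2.
  by rewrite expr2; exact: cvgM.
have /eqP : (inner (limn z) y - phi y) ^+ 2 = 0.
  by apply: cvg_unique uul dev0; exact: Rhausdorff.
by rewrite sqrf_eq0 subr_eq0 => /eqP.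
Unshelve. all: by end_near. Qed.

End InnerProduct.

(** * Weak sequential compactness *)

Lemma ultra_bounded_cvg {R : realType} (U : set_system nat) (u : nat -> R) (C : R) :
  UltraFilter U -> (forall k, `|u k| <= C) -> exists l : R, u @ U --> l.
Proof.
move=> UU uC.
have [|l [_ lU]] := @segment_compact R (- C) C (u @ U) _.
  by apply: (@filterE _ U) => k /=; rewrite in_itv /= -ler_norml uC.
exists l => A lA.
have [//|nA] := in_ultra_setVsetC (u @^-1` A) UU.
by have [x []] := lU (~` A) A nA lA.
Qed.

Section WeakConvergence.
Context {R : realType} {H : hilbertType R}.
Implicit Types (x : nat -> H) (y : H).

(** Boundedness makes the subspace of the [z] with
    [inner (x k) z --> inner x0 z] closed, so every vector splits orthogonally
    along it. Hence only the vectors orthogonal to all such [z] remain to be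
    tested. *)
Lemma weak_cvg_bounded x (x0 : H) (C : R) : (forall k, `|x k| <= C) ->
  (forall y, (forall z, (fun k => inner (x k) z) @ \oo --> inner x0 z ->
       inner y z = 0) ->
     (fun k => inner (x k) y) @ \oo --> inner x0 y) ->
  weak_cvg x x0.
Proof.
move=> xC xperp y.
pose M : set H := [set z | (fun k => inner (x k) z) @ \oo --> inner x0 z].
have MB a u v : M u -> M v -> M (a *: u + v).
  rewrite /M /= => hu hv; rewrite !innerE.
  under eq_fun do rewrite !innerE.
  by apply: cvgD => //; apply: cvgM => //; exact: cvg_cst.
have M0 : M 0.
  rewrite /M /= inner0r; under eq_fun do rewrite inner0r; exact: cvg_cst.
have Mcl : closed M.
  move=> z clz; rewrite /M /=.
  apply/cvgrPdist_le => e e0.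
  have C0 : 0 <= C by apply: le_trans (xC 0%N).
  pose D := C + `|x0| + 1.
  have D0 : 0 < D by rewrite ltr_wpDl // addr_ge0.
  have [|z' [Mz' zz']] := clz (ball z (e / (2 * D))).
    by apply: nbhsx_ballx; rewrite divr_gt0 // mulr_gt0.
  have e2 : 0 < e / 2 by rewrite divr_gt0.
  move/cvgrPdist_le/(_ _ e2): Mz'; apply: filterS => k /=.
  rewrite -!innerNl -!innerDl => hk.
  have -> : z = z' + (z - z') by rewrite addrC subrK.
  rewrite innerDr (le_trans (ler_normD _ _)) // [leRHS]splitr lerD //.
  rewrite (le_trans (inner_CauchySchwarz _ _)) //.
  move: zz'; rewrite -ball_normE /= => zz'.
  have nD : `|x0 - x k| <= D.
    rewrite (le_trans (ler_normB _ _)) // /D; have := xC k; lra.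
  apply: (@le_trans _ _ (D * (e / (2 * D)))).
    by apply: ler_pM => //; exact: ltW.
  by rewrite le_eqVlt; apply/orP; left; apply/eqP; field; rewrite gt_eqF.
have [p Mp hp] := @Riesz_closed_subspace R H M (inner y) `|y| M0 MB Mcl
  (fun a u v => ltac:(by rewrite !innerE)) (inner_CauchySchwarz y).
have -> : y = 1 *: p + (y - p) by rewrite scale1r addrC subrK.
apply: MB => //; apply: xperp => z Mz.
by rewrite innerDl innerNl hp // subrr.
Qed.

(** Weak sequential compactness of bounded sets. The limits of [inner (x k) y]
    along an ultrafilter define a bounded functional, represented by some [x0].
    Members of the ultrafilter are infinite, so there are indices [s k >= k] at
    which the inner products with [x 0, .., x k] are [k.+1^-1]-close to those of
    [x0]; this settles convergence against each [x j]. A vector orthogonal to all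
    the [x j] is orthogonal to [x0] as well, and [weak_cvg_bounded] concludes. *)
Lemma bounded_weak_subseq x (C : R) : (forall k, `|x k| <= C) ->
  exists (s : nat -> nat) (x0 : H), (forall k, (k <= s k)%N) /\
    weak_cvg (x \o s) x0.
Proof.
move=> xC.
have [U [UU ooU]] := @ultraFilterLemma nat \oo _.
have FU : ProperFilter U by case: UU.
have bd y k : `|inner (x k) y| <= C * `|y|.
  by rewrite (le_trans (inner_CauchySchwarz _ _)) // ler_wpM2r.
have /choice[phi phiP] (y : H) : exists l : R, (fun k => inner (x k) y) @ U --> l.
  exact: ultra_bounded_cvg (bd y).
have [//||a u v|y|x0 _ x0P] := @Riesz_closed_subspace R H setT phi C I _ _ _ _.
- exact: closedT.
- apply: (cvg_unique _ (phiP (a *: u + v))); first exact: Rhausdorff.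
  have -> : (fun k => inner (x k) (a *: u + v)) =
      (fun k => a * inner (x k) u + inner (x k) v).
    by apply/funext => k; rewrite !innerE.
  by apply: cvgD => //; apply: cvgM => //; exact: cvg_cst.
- apply: (@ler_cvg_to _ U _ R (fun k => `|inner (x k) y|) (fun=> C * `|y|)).
  + exact: cvg_norm.
  + exact: cvg_cst.
  + by near=> k; exact: bd.
have x0U y : (fun k => inner (x k) y) @ U --> inner x0 y.
  by rewrite -x0P //; exact: phiP.
have /choice[s sP] (k : nat) : exists i, (k <= i)%N /\
    forall j : 'I_k.+1, `|inner x0 (x j) - inner (x i) (x j)| <= k.+1%:R^-1.
  suff : U [set i | (k <= i)%N /\
     forall j : 'I_k.+1, `|inner x0 (x j) - inner (x i) (x j)| <= k.+1%:R^-1].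
    by move=> /filter_ex[i]; exists i.
  apply: filterI; first by apply: ooU; exact: nbhs_infty_ge.
  apply: filter_forall => j.
  have /cvgrPdist_le := x0U (x j); apply.
  by rewrite invr_gt0.
exists s, x0; split; first by move=> k; case: (sP k).
apply: (@weak_cvg_bounded _ _ C) => [k|y yP /=]; first exact: xC.
have xj j : (fun k => inner (x (s k)) (x j)) @ \oo --> inner x0 (x j).
  apply/cvgrPdist_le => e e0.
  have /cvgrPdist_le/(_ _ e0) hN := @cvg_harmonic R.
  near=> k.
  have jk : (j < k.+1)%N by near: k; exists j.
  have [_ /(_ (Ordinal jk)) /= h] := sP k.
  apply: le_trans h _.
  have : `|0 - k.+1%:R^-1| <= e by near: k.
  by rewrite sub0r normrN ger0_norm // invr_ge0.
have y0 k : inner (x k) y = 0 by rewrite innerC; apply: yP; exact: xj.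
have -> : inner x0 y = 0.
  apply: (cvg_unique _ (x0U y)); first exact: Rhausdorff.
  have -> : (fun k => inner (x k) y) = (fun=> 0) by apply/funext.
  exact: cvg_cst.
have -> : (fun k => inner (x (s k)) y) = (fun=> 0) by apply/funext => k; exact: y0.
exact: cvg_cst.
Unshelve. all: by end_near. Qed.

End WeakConvergence.

(** * Upper and lower limits of real sequences *)

Section Limits.
Context {R : realType}.
Implicit Types (u v : nat -> R) (a b : R).

(** The upper limit of [u] is at most [a], phrased by eventual bounds so that
    such facts combine by intersecting neighbourhoods of infinity. *)
Definition limsup_le u a : Prop :=
  forall e : R, 0 < e -> \forall k \near \oo, u k <= a + e.

Lemma limsup_le_cvg u v a : (\forall k \near \oo, u k <= v k) ->
  v @ \oo --> a -> limsup_le u a.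
Proof.
move=> uv /cvgrPdist_le va e e0; near=> k.
have : `|a - v k| <= e by near: k; exact: va.
rewrite ler_norml => /andP[h _].
have : u k <= v k by near: k.
lra.
Unshelve. all: by end_near. Qed.

Lemma dominated_harmonic_cvg u :
  (forall k, 0 <= u k <= k.+1%:R^-1) -> u @ \oo --> (0 : R).
Proof.
move=> uP; apply: (@squeeze_cvgr _ _ _ _ (fun=> 0) (@harmonic R)).
- by near=> k; exact: uP.
- exact: cvg_cst.
- exact: cvg_harmonic.
Unshelve. all: by end_near. Qed.

Lemma limn_einf_gt u a : (a%:E < limn_einf (fun k => (u k)%:E))%E ->
  \forall k \near \oo, a < u k.
Proof.
rewrite limn_einf_lim (cvg_lim _ (@cvg_einfs_sup _ _)) //.
move=> /ereal_sup_gt[_ [n _ <-] an]; exists n => // k /= nk.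
rewrite -lte_fin (lt_le_trans an) //.
by apply: ereal_inf_lbound; exists k.
Qed.

End Limits.

(** * Operator norm, quadratic forms and weak lower semicontinuity *)

Section Operators.
Context {R : realType} {H : hilbertType R}.
Implicit Types (A B : operator H) (x y : H).

Lemma continuous_linear_opnorm (A : {linear H -> H}) x :
  continuous A -> `|A x| <= opnorm A * `|x|.
Proof.
move=> Ac.
have [M /nbhs_ballP[r /= r0 hM]] : exists M : R, nbhs (0 : H) [set x | `|A x| <= M].
  by apply/ex_bound; apply: continuous_linear_bounded; exact: Ac.
have ub : has_ubound [set `|A x| | x in [set x : H | `|x| <= 1]].
  exists (2 / r * M) => _ [y /= y1 <-].
  have -> : y = (2 / r) *: ((r / 2) *: y).
    rewrite scalerA (_ : 2 / r * (r / 2) = 1) ?scale1r //.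
    by field; rewrite gt_eqF.
  rewrite linearZ normrZ ger0_norm ?divr_ge0 ?(ltW r0) //.
  rewrite ler_wpM2l ?divr_ge0 ?(ltW r0) //; apply: hM => /=.
  rewrite -ball_normE /= sub0r normrN normrZ ger0_norm ?divr_ge0 ?(ltW r0) //.
  by have := normr_ge0 y; nra.
have [->|x0] := eqVneq x 0; first by rewrite linear0 !normr0 mulr0.
have nx : 0 < `|x| by rewrite normr_gt0.
rewrite -ler_pdivrMr // mulrC -[X in X * _]ger0_norm ?invr_ge0 // -normrZ -linearZ.
apply: ub_le_sup => //; exists (`|x|^-1 *: x) => //=.
by rewrite normrZ ger0_norm ?invr_ge0 // mulVf // gt_eqF.
Qed.

Lemma opnorm_sub A B x : `|A x - B x| <= opnorm (A \- B) * `|x|.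
Proof.
apply: (@continuous_linear_opnorm (A \- B)) => z.
by apply: cvgB; apply: operator_continuous.
Qed.

Lemma operatorD A x y : A (x + y) = A x + A y.
Proof. exact: linearD. Qed.

Lemma operatorB A x y : A (x - y) = A x - A y.
Proof. exact: linearB. Qed.

Lemma operatorZ A (a : R) x : A (a *: x) = a *: A x.
Proof. exact: linearZ. Qed.

Lemma self_adjointC A x y : self_adjoint A -> inner x (A y) = inner y (A x).
Proof. by move=> sA; rewrite innerC sA. Qed.

(** The defect term is where positive semidefiniteness yields convexity. *)
Lemma quadratic_segment A x y (t : R) : self_adjoint A ->
  inner (x + t *: (y - x)) (A (x + t *: (y - x))) =
  (1 - t) * inner x (A x) + t * inner y (A y)
  - t * (1 - t) * inner (y - x) (A (y - x)).
Proof.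
move=> sA; rewrite operatorD operatorZ operatorB !innerE (self_adjointC x y sA); ring.
Qed.

(** A nonnegative quadratic form vanishing at [x] is minimal there, so its
    gradient [A x] vanishes too. *)
Lemma psd_ker A x : self_adjoint A -> positive_semidefinite A ->
  inner x (A x) <= 0 -> A x = 0.
Proof.
move=> sA pA Ax0; apply/eqP/negPn/negP => Axn.
have n0 : 0 < inner (A x) (A x) by rewrite -sqr_norm_inner exprn_gt0 ?normr_gt0.
set n := inner (A x) (A x) in n0; have q0 := pA (A x).
set q := inner (A x) (A (A x)) in q0.
(* Along [- A x] the form is [inner x (A x) - 2 s n + s^2 q], negative for this
   small step [s]. *)
pose s := n / (q + 1).
have s0 : 0 < s by rewrite divr_gt0 // ltr_wpDl.
have qs : s * (q + 1) = n by rewrite /s divfK // gt_eqF // ltr_wpDl.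
have := pA (x + (- s) *: A x).
rewrite operatorD operatorZ !innerE (self_adjointC x (A x) sA) -/n -/q; nra.
Qed.

(** Nonnegativity at [x k - x0] bounds the form at [x k] below by its tangent at
    [x0], which is weakly continuous. *)
Lemma psd_weakly_lsc A (x : nat -> H) (x0 : H) (a : R) :
  self_adjoint A -> positive_semidefinite A -> weak_cvg x x0 ->
  limsup_le (fun k => inner (x k) (A (x k))) a -> inner x0 (A x0) <= a.
Proof.
move=> sA pA xx0 xa; apply/ler_addgt0Pr => e e0.
have e3 : 0 < e / 3 by rewrite divr_gt0.
have /cvgrPdist_le/(_ _ e3) h1 := xx0 (A x0).
have [k [h2 h3]] := filter_ex (filterI h1 (xa _ e3)).
have := pA (x k - x0).
rewrite operatorB !innerE (self_adjointC x0 (x k) sA).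
move: h2; rewrite ler_norml => /andP[h2 h4]; lra.
Qed.

Lemma weakly_lsc_limsup (Q : H -> R) (x : nat -> H) (x0 : H) (a : R) :
  weakly_lsc Q -> weak_cvg x x0 -> limsup_le (Q \o x) a -> Q x0 <= a.
Proof.
move=> Ql xx0 xa; rewrite leNgt; apply/negP => aQ.
pose e := (Q x0 - a) / 2.
have e0 : 0 < e by rewrite divr_gt0 // subr_gt0.
have h : ((a + e)%:E < limn_einf (fun k => (Q (x k))%:E))%E.
  by apply: lt_le_trans (Ql _ _ xx0); rewrite lte_fin /e; lra.
have [k [/= h1 h2]] := filter_ex (filterI (limn_einf_gt h) (xa _ e0)).
by move: h1; rewrite ltNge h2.
Qed.

(** Weak lower semicontinuity supplies the other half of the convergence of
    [Q (x k)]. *)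
Lemma Legendre_limsup_cvg (Q : H -> R) (x : nat -> H) (x0 : H) :
  Legendre_form Q -> weak_cvg x x0 -> limsup_le (Q \o x) (Q x0) -> x @ \oo --> x0.
Proof.
move=> [_ Ql QS] xx0 xa; apply: QS => //.
apply/cvgrPdist_le => e e0.
have h : ((Q x0 - e)%:E < limn_einf (fun k => (Q (x k))%:E))%E.
  by apply: lt_le_trans (Ql _ _ xx0); rewrite lte_fin; lra.
apply: filterS (filterI (limn_einf_gt h) (xa _ e0)) => k [/= h1 h2].
rewrite ler_norml; lra.
Qed.

End Operators.

(** * Perturbed quadratic programs *)

Section Perturbation.
Context {R : realType} {H : hilbertType R} {m : nat}.
Implicit Types (w : qp_data H m) (x y : H).

Lemma qp_dist_bounds (w' w : qp_data H m) :
  [/\ 0 <= qp_dist w' w,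
      opnorm (obj_op w' \- obj_op w) <= qp_dist w' w,
      `|obj_vec w' - obj_vec w| <= qp_dist w' w
    & forall i, [/\ opnorm (cons_op w' i \- cons_op w i) <= qp_dist w' w,
        `|cons_vec w' i - cons_vec w i| <= qp_dist w' w
      & `|cons_cst w' i - cons_cst w i| <= qp_dist w' w]].
Proof.
rewrite /qp_dist; split=> [|||i]; last split; rewrite !le_max ?lexx ?orbT //.
- by rewrite normr_ge0 orbT.
- by rewrite [X in [|| _, _, X | _]]le_bigmax ?orbT.
- by rewrite [X in [|| _, _, _, X | _]]le_bigmax ?orbT.
- by rewrite [X in [|| _, _, _, _ | X]]le_bigmax ?orbT.
Qed.

Lemma inner_operator_perturb (A B : operator H) (d : R) x :
  opnorm (A \- B) <= d -> `|inner x (A x) - inner x (B x)| <= d * `|x| ^+ 2.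
Proof.
move=> ABd; rewrite -innerNr -innerDr.
rewrite (le_trans (inner_CauchySchwarz _ _)) //.
rewrite expr2 mulrCA ler_wpM2l //.
by rewrite (le_trans (opnorm_sub A B x)) // ler_wpM2r.
Qed.

Lemma inner_vec_perturb (c c' : H) (d : R) x :
  `|c - c'| <= d -> `|inner c x - inner c' x| <= d * `|x|.
Proof.
move=> cd; rewrite -innerNl -innerDl.
by rewrite (le_trans (inner_CauchySchwarz _ _)) // ler_wpM2r.
Qed.

Lemma objective_perturb (w' w : qp_data H m) x :
  `|objective x w' - objective x w| <= qp_dist w' w * (1 + `|x|) ^+ 2.
Proof.
have [d0 h1 h2 _] := qp_dist_bounds w' w.
have := inner_operator_perturb x h1; have := inner_vec_perturb x h2.
have x0 := normr_ge0 x.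
rewrite /objective !ler_norml => /andP[a1 a2] /andP[b1 b2].
have dx : 0 <= qp_dist w' w * `|x| by rewrite mulr_ge0.
have dxx : 0 <= qp_dist w' w * `|x| ^+ 2 by rewrite mulr_ge0 // sqr_ge0.
apply/andP; split; nra.
Qed.

Lemma constraint_perturb i (w' w : qp_data H m) x :
  `|constraint i x w' - constraint i x w| <= qp_dist w' w * (1 + `|x|) ^+ 2.
Proof.
have [d0 _ _ /(_ i)[h1 h2 h3]] := qp_dist_bounds w' w.
have := inner_operator_perturb x h1; have := inner_vec_perturb x h2; move: h3.
have x0 := normr_ge0 x.
rewrite /constraint !ler_norml => /andP[c1 c2] /andP[a1 a2] /andP[b1 b2].
have dx : 0 <= qp_dist w' w * `|x| by rewrite mulr_ge0.
have dxx : 0 <= qp_dist w' w * `|x| ^+ 2 by rewrite mulr_ge0 // sqr_ge0.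
apply/andP; split; nra.
Qed.

Lemma SolP w x :
  Sol w x <-> feasible w x /\ forall y, feasible w y -> objective x w <= objective y w.
Proof.
split=> [[Fx xE]|[Fx xmin]]; split=> //.
  move=> y Fy; rewrite -lee_fin xE; apply: ereal_inf_lbound; by exists y.
apply/eqP; rewrite eq_le; apply/andP; split.
  by apply: le_ereal_inf_tmp => _ [y Fy <-]; rewrite lee_fin xmin.
by apply: ereal_inf_lbound; exists x.
Qed.

(** Moving from [y] slightly towards a strictly feasible point makes every
    convex constraint strict and changes the objective continuously. *)
Lemma strictly_feasible_approx w y (e : R) : Omega w -> regular_system w ->
  feasible w y -> 0 < e ->
  exists2 z, (forall i, constraint i z w < 0) & objective z w <= objective y w + e.
Proof.
move=> [sT TP] [s sP] Fy e0.
pose B := objective s w - objective y w.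
pose D := 2^-1 * inner (s - y) (obj_op w (s - y)).
(* The step [t = e / K] is at most 1 and keeps the change of the objective,
   [t B - t (1 - t) D], below [e]. *)
pose K := `|B| + `|D| + e.
have K0 : 0 < K by rewrite ltr_wpDl // addr_ge0.
pose t := e / K.
have tK : t * K = e by rewrite /t divfK // gt_eqF.
have t0 : 0 < t by rewrite divr_gt0.
have t1 : t <= 1 by rewrite ler_pdivrMr // mul1r /K lerDr addr_ge0.
exists (y + t *: (s - y)) => [i|].
  have [sTi pTi] := TP i.
  have := sP i; have := Fy i; have := pTi (s - y).
  rewrite /constraint quadratic_segment //.
  move: (inner (s - y) (cons_op w i (s - y))) => q; rewrite !innerE => q0 gy gs.
  have tq : 0 <= t * (1 - t) * q by rewrite mulr_ge0 // mulr_ge0 ?subr_ge0 // ltW.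
  nra.
have -> : objective (y + t *: (s - y)) w = objective y w + t * B - t * (1 - t) * D.
  rewrite /B /D /objective quadratic_segment //.
  by move: (inner (s - y) (obj_op w (s - y))) => q; rewrite !innerE; ring.
have h1 : t * B <= t * `|B| by rewrite ler_pM2l // ler_norm.
have h2 : - (t * (1 - t) * D) <= t * `|D|.
  have := ler_norm (- D); rewrite normrN => hD.
  have D0 := normr_ge0 D.
  have : (1 - t) * (- D) <= `|D| by nra.
  by rewrite -(ler_pM2l t0); lra.
rewrite /K in tK; nra.
Qed.

End Perturbation.

(** * Limits of solutions of perturbed programs *)

Section SequencesOfSolutions.
Context {R : realType} {H : hilbertType R} {m : nat}.
Context (w : qp_data H m) (W : nat -> qp_data H m) (x : nat -> H).
Context (w_Omega : Omega w) (w_regular : regular_system w).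
Context (T_Legendre : Legendre_form (fun x : H => inner x (obj_op w x))).
Context (W_Omega : forall k, Omega (W k)).
Context (W_cvg : (fun k => qp_dist (W k) w) @ \oo --> (0 : R)).
Context (x_Sol : forall k, Sol (W k) (x k)).

Let d k := qp_dist (W k) w.

Let d_ge0 k : 0 <= d k. Proof. by have [] := qp_dist_bounds (W k) w. Qed.

Let weak_cvgC (z : nat -> H) z0 c : weak_cvg z z0 ->
  (fun k => inner c (z k)) @ \oo --> inner c z0.
Proof. by move=> zz0; rewrite innerC; under eq_fun do rewrite innerC; exact: zz0. Qed.

Lemma strictly_feasible_near y : (forall i, constraint i y w < 0) ->
  \forall k \near \oo, feasible (W k) y.
Proof.
move=> yP; apply: filter_forall => i.
have K0 : 0 < (1 + `|y|) ^+ 2 by rewrite exprn_gt0 // ltr_pwDl.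
have e0 : 0 < - constraint i y w / (1 + `|y|) ^+ 2.
  by rewrite divr_gt0 // oppr_gt0.
have /cvgrPdist_le/(_ _ e0) := W_cvg.
apply: filterS => k; rewrite sub0r normrN ger0_norm ?d_ge0 // ler_pdivlMr //.
have := constraint_perturb i (W k) w y; rewrite ler_norml => /andP[_]; lra.
Qed.

(** The comparison behind both limit arguments: against a fixed competitor that
    is strictly feasible for [w], the objective value of [x k] is controlled up
    to the perturbation errors at the competitor and at [x k]. *)
Lemma objective_Sol_near y : (forall i, constraint i y w < 0) ->
  \forall k \near \oo, objective (x k) w <=
    objective y w + d k * (1 + `|y|) ^+ 2 + d k * (1 + `|x k|) ^+ 2.
Proof.
move=> /strictly_feasible_near; apply: filterS => k Fy.
have /SolP[_ /(_ _ Fy)] := x_Sol k.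
have := objective_perturb (W k) w y; have := objective_perturb (W k) w (x k).
rewrite !ler_norml /d => /andP[h1 _] /andP[_ h2]; lra.
Qed.

Lemma constraint_Sol i k : constraint i (x k) w <= d k * (1 + `|x k|) ^+ 2.
Proof.
have /SolP[/(_ i) h _] := x_Sol k.
have := constraint_perturb i (W k) w (x k).
rewrite ler_norml => /andP[h1 _]; rewrite /d; lra.
Qed.

(** Comparison with strictly feasible points gives optimality of the weak limit;
    comparison with those that approach [x0] itself gives the upper bound on the
    quadratic part that the Legendre property requires. *)
Lemma Sol_weak_limit (C : R) (x0 : H) : (forall k, `|x k| <= C) ->
  weak_cvg x x0 -> Sol w x0 /\ x @ \oo --> x0.
Proof.
move=> xC xx0.
have [sT TP] := w_Omega.
have errC k : d k * (1 + `|x k|) ^+ 2 <= d k * (1 + C) ^+ 2.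
  rewrite ler_wpM2l // ler_pXn2r ?nnegrE ?lerD2l ?addr_ge0 //.
  exact: le_trans (xC k).
have Fx0 : feasible w x0.
  move=> i; have [sTi pTi] := TP i.
  have := @psd_weakly_lsc _ _ (cons_op w i) x x0
    (2 * (0 * (1 + C) ^+ 2 - inner (cons_vec w i) x0 - cons_cst w i))
    sTi pTi xx0.
  suff /[swap]/[apply] : limsup_le (fun k => inner (x k) (cons_op w i (x k)))
      (2 * (0 * (1 + C) ^+ 2 - inner (cons_vec w i) x0 - cons_cst w i)).
    by rewrite /constraint; lra.
  apply: (@limsup_le_cvg _ _ (fun k =>
    2 * (d k * (1 + C) ^+ 2 - inner (cons_vec w i) (x k) - cons_cst w i))).
    near=> k; have := constraint_Sol i k; have := errC k.
    by rewrite /constraint; lra.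
  apply: cvgM; first exact: cvg_cst.
  apply: cvgB; last exact: cvg_cst.
  apply: cvgB; last exact: weak_cvgC.
  by apply: cvgM; [exact: W_cvg|exact: cvg_cst].
have Qle y : (forall i, constraint i y w < 0) ->
    limsup_le (fun k => inner (x k) (obj_op w (x k)))
              (2 * (objective y w - inner (obj_vec w) x0)).
  move=> yP; pose K := (1 + `|y|) ^+ 2 + (1 + C) ^+ 2.
  apply: (@limsup_le_cvg _ _ (fun k =>
    2 * (objective y w + d k * K - inner (obj_vec w) (x k)))).
    apply: filterS (objective_Sol_near yP) => k.
    by have := errC k; rewrite /K mulrDr {1}/objective; lra.
  apply: cvgM; first exact: cvg_cst.
  apply: cvgB; last exact: weak_cvgC.
  rewrite -[X in _ --> X]addr0 -[X in _ + X](mul0r K).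
  apply: cvgD; first exact: cvg_cst.
  by apply: cvgM; [exact: W_cvg|exact: cvg_cst].
have Sx0 : Sol w x0.
  apply/SolP; split=> // y Fy; apply/ler_addgt0Pr => e e0.
  have [z zP zy] := strictly_feasible_approx w_Omega w_regular Fy e0.
  apply: le_trans zy; rewrite {1}/objective.
  have [_ Tl _] := T_Legendre.
  have := weakly_lsc_limsup Tl xx0 (Qle z zP); lra.
split=> //; apply: (Legendre_limsup_cvg T_Legendre xx0) => e e0.
have e4 : 0 < e / 4 by rewrite divr_gt0.
have [z zP zx0] := strictly_feasible_approx w_Omega w_regular Fx0 e4.
have e2 : 0 < e / 2 by rewrite divr_gt0.
apply: filterS (Qle z zP _ e2) => k /=.
by move: zx0; rewrite {2}/objective; lra.
Unshelve. all: by end_near. Qed.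

(** After division by [|x k|^2] only the quadratic parts survive, and the
    perturbation error [d k * (1 + |x k|)^2] becomes of order [d k]. *)
Lemma normalized_Sol_weak_limit (v : H) : (forall k, k.+1%:R <= `|x k|) ->
  weak_cvg (fun k => `|x k|^-1 *: x k) v ->
  recession_cone w v /\
  limsup_le (fun k => inner (`|x k|^-1 *: x k) (obj_op w (`|x k|^-1 *: x k))) 0.
Proof.
move=> xlarge vv.
have [sT TP] := w_Omega.
pose t k : R := `|x k|^-1.
have nx k : 0 < `|x k| by apply: lt_le_trans (xlarge k).
have t0 k : 0 < t k by rewrite invr_gt0.
have tx k : t k * `|x k| = 1 by rewrite /t mulVf // gt_eqF.
have tcvg : t @ \oo --> (0 : R).
  by apply: dominated_harmonic_cvg => k; rewrite ltW //= /t lef_pV2 ?posrE.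
pose y k := t k *: x k.
have scal c k : inner c (y k) = t k * inner c (x k) by rewrite innerZr.
have quad (A : operator H) k : inner (y k) (A (y k)) = t k ^+ 2 * inner (x k) (A (x k)).
  by rewrite /y operatorZ innerZl innerZr expr2 mulrA.
have err k : t k ^+ 2 * (d k * (1 + `|x k|) ^+ 2) = d k * (t k + 1) ^+ 2.
  by have -> : t k + 1 = t k * (1 + `|x k|) by [rewrite mulrDr mulr1 tx]; ring.
have ttcvg : (t \* t) @ \oo --> (0 : R).
  by rewrite -[X in _ --> X](mul0r 0); exact: cvgM.
have errcvg : (fun k => d k * (t k + 1) ^+ 2) @ \oo --> (0 : R).
  rewrite -[X in _ --> X](mul0r ((0 + 1) * (0 + 1))).
  apply: cvgM; first exact: W_cvg.
  by apply: cvgM; apply: cvgD => //; exact: cvg_cst.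
have lin0 c : (fun k => t k * inner c (y k)) @ \oo --> (0 : R).
  rewrite -[X in _ --> X](mul0r (inner c v)).
  by apply: cvgM => //; exact: weak_cvgC.
(* Serves the objective, with [b] the value at a competitor, and each
   constraint, with [- b] its constant term: the factor [t k ^+ 2] kills [b] and
   the linear part, and tames the error growing like [`|x k| ^+ 2]. *)
have limquad (A : operator H) c (b : R) (r : nat -> R) :
    r @ \oo --> (0 : R) ->
    (\forall k \near \oo, 2^-1 * inner (x k) (A (x k)) + inner c (x k)
        <= b + r k + d k * (1 + `|x k|) ^+ 2) ->
    limsup_le (fun k => inner (y k) (A (y k))) 0.
  move=> r0 rP.
  apply: (@limsup_le_cvg _ _ (fun k => 2 * (t k * t k * (b + r k)
    + d k * (t k + 1) ^+ 2 - t k * inner c (y k)))).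
    apply: filterS rP => k; rewrite -(ler_pM2l (exprn_gt0 2 (t0 k))).
    rewrite quad scal -err.
    set q := inner (x k) _; set l := inner c _; set e := d k * _; lra.
  have -> : (0 : R) = 2 * (0 * (b + 0) + 0 - 0) by ring.
  apply: cvgM; first exact: cvg_cst.
  apply: cvgB => //; apply: cvgD => //; apply: cvgM => //.
  by apply: cvgD => //; exact: cvg_cst.
split; last first.
  have [s sP] := w_regular.
  apply: (limquad _ (obj_vec w) (objective s w)
    (fun k => d k * (1 + `|s|) ^+ 2)); last exact: objective_Sol_near.
  rewrite -[X in _ --> X](mul0r ((1 + `|s|) ^+ 2)).
  by apply: cvgM; [exact: W_cvg|exact: cvg_cst].
move=> i; have [sTi pTi] := TP i; split.
  apply: psd_ker => //; apply: psd_weakly_lsc vv _ => //.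
  apply: (limquad _ (cons_vec w i) (- cons_cst w i) (fun=> 0)).
    exact: cvg_cst.
  near=> k; have := constraint_Sol i k; rewrite /constraint; lra.
(* Dropping the nonnegative quadratic term of the perturbed constraint leaves an
   affine inequality, which survives division by the norm of [x k] alone. *)
have lin k : inner (cons_vec w i) (y k) <= t k * (d k - cons_cst w i) + d k.
  have /SolP[/(_ i) h _] := x_Sol k.
  have [_ /(_ i)[_ /(_ (x k)) p]] := W_Omega k.
  have [_ _ _ /(_ i)[_ hc ha]] := qp_dist_bounds (W k) w.
  have := inner_vec_perturb (x k) hc; move: ha h.
  rewrite !ler_norml /constraint -/(d k) => /andP[a1 _] h /andP[c1 _].
  rewrite scal -[X in _ + X]mul1r -(tx k) -mulrA -mulrDr ler_pM2l //.
  by rewrite (mulrC `|x k|); lra.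
apply: (@ler_cvg_to _ \oo _ R (fun k => inner (cons_vec w i) (y k))
  (fun k => t k * (d k - cons_cst w i) + d k)).
- exact: weak_cvgC.
- rewrite -[X in _ --> X](_ : 0 * (0 - cons_cst w i) + 0 = 0); last by ring.
  apply: cvgD; last exact: W_cvg.
  apply: cvgM => //; apply: cvgB; [exact: W_cvg|exact: cvg_cst].
- by near=> k; exact: lin.
Unshelve. all: by end_near. Qed.

End SequencesOfSolutions.

(** * Upper semicontinuity *)

Lemma SolQPR_trivial_eq0 (R : realType) (H : hilbertType R) (m : nat)
    (w : qp_data H m) (v : H) :
  SolQPR w = [set 0] -> recession_cone w v -> inner v (obj_op w v) <= 0 -> v = 0.
Proof.
move=> QPR0 vrec vT; have : SolQPR w 0 by rewrite QPR0.
move=> [_ min0]; suff : SolQPR w v by rewrite QPR0.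
split=> // u /min0; rewrite linear0 inner0r mulr0; lra.
Qed.

Theorem theorem2p1 (R : realType) (H : hilbertType R) (m : nat) (w : qp_data H m)
    (m_ge1 : (1 <= m)%N)
    (w_Omega : Omega w)
    (T_Legendre : Legendre_form (fun x : H => inner x (obj_op w x)))
    (QPR_trivial : SolQPR w = [set 0])
    (w_regular : regular_system w) :
  usc_at Sol w.
Proof.
move=> V Vo SV; apply: contrapT => nusc.
pose Bad (e : R) (p : qp_data H m * H) :=
  [/\ Omega p.1, qp_dist p.1 w < e, Sol p.1 p.2 & ~ V p.2].
have bad e : 0 < e -> exists p, Bad e p.
  move=> e0; apply: contrapT => nbad; apply: nusc; exists e => // w' Ow' dw' x Sx.
  by apply: contrapT => nVx; apply: nbad; exists (w', x).
have inv_gt0 k : 0 < k.+1%:R^-1 :> R by rewrite invr_gt0.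
(* Indices [s k >= k] keep the rate [k.+1^-1] along the extracted sequence. *)
have data_cvg (p : nat -> qp_data H m * H) (s : nat -> nat) :
    (forall k, Bad k.+1%:R^-1 (p k)) -> (forall k, (k <= s k)%N) ->
    (fun k => qp_dist (p (s k)).1 w) @ \oo --> (0 : R).
  move=> pP sP; apply: dominated_harmonic_cvg => k.
  have [d0 _ _ _] := qp_dist_bounds (p (s k)).1 w; rewrite d0 /=.
  have [_ /ltW h _ _] := pP (s k); apply: le_trans h _.
  by rewrite lef_pV2 ?posrE // ler_nat ltnS.
(* Either offending solutions within one fixed bound exist arbitrarily close to
   [w], or their norms are forced to infinity as the data approach [w]. *)
have [[C hC]|nC] := pselect (exists C : R,
    forall e, 0 < e -> exists2 p, Bad e p & `|p.2| <= C).
  have /choice[p pP] (k : nat) : exists p, Bad k.+1%:R^-1 p /\ `|p.2| <= C.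
    by have [p] := hC _ (inv_gt0 k); exists p.
  have [s [x0 [sk xx0]]] :=
    @bounded_weak_subseq _ _ (fun k => (p k).2) C (fun k => (pP k).2).
  have [|k|k|/SV Vx0 cx0] := @Sol_weak_limit _ _ _ w (fun k => (p (s k)).1)
    (fun k => (p (s k)).2) w_Omega w_regular T_Legendre _ _ C x0 _ xx0.
  - by apply: data_cvg => // k; case: (pP k).
  - by case: (pP (s k)) => -[].
  - by case: (pP (s k)).
  have nearV : \forall k \near \oo, V (p (s k)).2.
    exact: cx0 _ (open_nbhs_nbhs (conj Vo Vx0)).
  have [k Vk] := filter_ex nearV.
  by case: (pP (s k)) => -[].
have /choice[p pP] (k : nat) : exists p,
    Bad k.+1%:R^-1 p /\ k.+1%:R <= `|p.2|.
  apply: contrapT => np; apply: nC; exists k.+1%:R => e e0.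
  have [|p [Op dp Sp nVp]] := bad (Num.min e k.+1%:R^-1).
    by rewrite lt_min e0 inv_gt0.
  move: dp; rewrite lt_min => /andP[de dk]; exists p => //.
  rewrite leNgt; apply/negP => hp; apply: np; exists p; split=> //.
  exact: ltW.
have nx k : 0 < `|(p k).2| by apply: lt_le_trans (pP k).2.
have unit_norm k : `| `|(p k).2|^-1 *: (p k).2 | = 1.
  by rewrite normrZ ger0_norm ?invr_ge0 // mulVf // gt_eqF.
have [s [v [sk vv]]] :=
  @bounded_weak_subseq _ _ (fun k => `|(p k).2|^-1 *: (p k).2) 1
    (fun k => ltac:(by rewrite unit_norm)).
have [k||k|k|vrec vlim] := @normalized_Sol_weak_limit _ _ _ w
    (fun k => (p (s k)).1) (fun k => (p (s k)).2) w_Omega w_regular _ _ _ v _ vv.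
- by case: (pP (s k)) => -[].
- by apply: data_cvg => // k; case: (pP k).
- by case: (pP (s k)) => -[].
- by apply: le_trans (pP (s k)).2; rewrite ler_nat ltnS.
have [_ Tl _] := T_Legendre.
have v0 := SolQPR_trivial_eq0 QPR_trivial vrec (weakly_lsc_limsup Tl vv vlim).
rewrite v0 in vv.
have := @Legendre_limsup_cvg _ _ _ _ 0 T_Legendre vv.
rewrite inner0l => /(_ vlim) /cvg_norm; rewrite normr0.
rewrite (_ : (fun k => `|_|) = fun=> 1); last by apply/funext => k; exact: unit_norm.
move=> h.
have : (1 : R) = 0 by apply: cvg_unique h => //; exact: cvg_cst.
by move/eqP; rewrite oner_eq0.
Qed.
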